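(* Let $n\ge 0$ and $r\ge 3$ be integers and let $f:\mathbb{N}\to\mathbb{R}$ be a non-decreasing function. Then $$\mathrm{ex}_f(n,K_r)=\mathrm{ex}_f'(n,K_r),$$ that is, the maximum of $e_f(G)$ over all $K_r$-free graphs $G$ of order $n$ equals the maximum of $e_f(H)$ over all complete $(r-1)$-partite graphs $H$ of order $n$.
   Context: $\mathbb{N}$ denotes the set of non-negative integers and $\mathbb{R}$ the set of reals. Graphs are finite and simple; the order of a graph is its number of vertices. $K_r$ is the complete graph on $r$ vertices. A function $f:\mathbb{N}\to\mathbb{R}$ is non-decreasing if $f(m)\le f(n)$ whenever $m\le n$. For a function $f:\mathbb{N}\to\mathbb{R}$ and a graph $G$, define $e_f(G)=\sum_{x\in V(G)} f(d(x))$, where $d(x)$ is the degree of the vertex $x$ in $G$. For a graph $F$, a graph is $F$-free if it contains no (not necessarily induced) subgraph isomorphic to $F$. $\mathrm{ex}_f(n,F)$ is the maximum of $e_f(G)$ over all $F$-free graphs $G$ of order $n$. $\mathrm{ex}_f'(n,F)$ is the maximum of $e_f(H)$ over all complete $(\chi(F)-1)$-partite graphs $H$ of order $n$, where $\chi(F)$ is the chromatic number of $F$ (so $\chi(K_r)-1=r-1$). A complete $k$-partite graph is a graph whose vertex set is partitioned into $k$ parts (empty parts allowed), with two vertices adjacent if and only if they lie in different parts. *)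

(* Defs.v *)
From HB Require Import structures.
From mathcomp Require Import all_boot all_order all_algebra.
From mathcomp Require Import boolp classical_sets reals.

Set Implicit Arguments.
Unset Strict Implicit.
Unset Printing Implicit Defensive.

Import Order.TTheory GRing.Theory Num.Theory.
Local Open Scope classical_set_scope.
Local Open Scope ring_scope.

Record sgraph := SGraph {
  vertex :> finType;
  adj : rel vertex;
  adj_sym : symmetric adj;
  adj_irr : irreflexive adj }.

Definition order_of (G : sgraph) : nat := #|G|.

Definition degree (G : sgraph) (x : G) : nat := #|[pred y | adj x y]|.

Fact neq_sym (T : eqType) : symmetric (fun x y : T => x != y).
Proof. by move=> x y; rewrite eq_sym. Qed.

Fact neq_irr (T : eqType) : irreflexive (fun x y : T => x != y).
Proof. by move=> x; rewrite eqxx. Qed.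

Definition complete_graph (r : nat) : sgraph :=
  SGraph (@neq_sym 'I_r) (@neq_irr 'I_r).

(* Subgraphs are not required to be induced: h need only preserve edges. *)
Definition has_copy (F G : sgraph) : Prop :=
  exists h : F -> G, injective h /\ {homo h : x y / adj x y}.

Definition is_free (F G : sgraph) : Prop := ~ has_copy F G.

Definition colorable (G : sgraph) (k : nat) : bool :=
  [exists c : {ffun G -> 'I_k},
    [forall x : G, forall y : G, adj x y ==> (c x != c y)]].

Fact colorable_ex (G : sgraph) : exists k, colorable G k.
Proof.
exists #|G|; apply/existsP; exists [ffun x => enum_rank x].
apply/forallP => x; apply/forallP => y; apply/implyP => xy; rewrite !ffunE.
by apply: contraTneq xy => /enum_rank_inj ->; rewrite adj_irr.
Qed.

Definition chromatic_number (G : sgraph) : nat := ex_minn (colorable_ex G).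

(* The fibres of p are the k parts; p is not assumed to be surjective, so
   parts may be empty. *)
Definition complete_partite (k : nat) (G : sgraph) : Prop :=
  exists p : G -> 'I_k, forall x y : G, adj x y = (p x != p y).

Definition degree_sum (R : realType) (f : nat -> R) (G : sgraph) : R :=
  \sum_(x : G) f (degree x).

Definition is_maximum (R : realType) (A : set R) (m : R) : Prop :=
  A m /\ ubound A m.

(* The default value 0 is used only when A has no greatest element;
   ex_f_K_max and ex_f'_K_max below show that this never happens for the
   extremal numbers of complete graphs on at least two vertices. *)
Definition maximum (R : realType) (A : set R) : R := xget 0 (is_maximum A).

Definition free_values (R : realType) (f : nat -> R) (n : nat) (F : sgraph)
    : set R :=
  [set m | exists G : sgraph,
    [/\ order_of G = n, is_free F G & degree_sum f G = m]].

Definition partite_values (R : realType) (f : nat -> R) (n : nat) (F : sgraph)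
    : set R :=
  [set m | exists H : sgraph,
    [/\ order_of H = n, complete_partite (chromatic_number F).-1 H
      & degree_sum f H = m]].

Definition ex_f (R : realType) (f : nat -> R) (n : nat) (F : sgraph) : R :=
  maximum (free_values f n F).

Definition ex_f' (R : realType) (f : nat -> R) (n : nat) (F : sgraph) : R :=
  maximum (partite_values f n F).

Lemma degree_lt (G : sgraph) (x : G) : (degree x < #|G|)%N.
Proof.
rewrite /degree -(cardC [pred y | adj x y]) -[X in (X < _)%N]addn0 ltn_add2l.
by apply/card_gt0P; exists x; rewrite !inE adj_irr.
Qed.

Lemma maximum_degree_sum (R : realType) (f : nat -> R) (n : nat)
    (P : sgraph -> Prop) (G0 : sgraph) :
  order_of G0 = n -> P G0 ->
  let A : set R := [set m | exists G : sgraph,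
    [/\ order_of G = n, P G & degree_sum f G = m]] in
  is_maximum A (maximum A).
Proof.
move=> oG0 PG0 A; rewrite /maximum.
pose v (d : {ffun 'I_n -> 'I_n}) : R := \sum_i f (d i).
have vP G : order_of G = n -> exists d, degree_sum f G = v d.
  rewrite /order_of /v => oG; clear -oG; subst n.
  exists [ffun i => Ordinal (degree_lt (enum_val i))].
  rewrite /degree_sum (reindex (@enum_val G G)) /=; last first.
    by apply: onW_bij; apply: enum_val_bij.
  by apply: eq_bigr => i _; rewrite ffunE.
have [d0 vd0] := vP _ oG0.
have Ad0 : `[< A (v d0) >] by apply/asboolP; exists G0.
case: (arg_maxP (P := fun d => `[< A (v d) >]) v Ad0) => d /asboolP Ad dmax.
apply: (@xgetPex _ 0 (is_maximum A)); exists (v d); split=> // _ [G [oG PG <-]].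
have [e ve] := vP _ oG; rewrite ve; apply: dmax; apply/asboolP.
by rewrite -ve; exists G.
Qed.

Lemma chromatic_number_complete (r : nat) :
  chromatic_number (complete_graph r) = r.
Proof.
rewrite /chromatic_number; case: ex_minnP => k /existsP[c /forallP cP] kmin.
apply/eqP; rewrite eqn_leq; apply/andP; split.
  apply: kmin; apply/existsP; exists [ffun x => x].
  by apply/forallP => x; apply/forallP => y; rewrite !ffunE; apply/implyP.
suff /leq_card : injective c by rewrite !card_ord.
move=> x y cxy; apply/eqP; apply: contraT => xy.
by have /forallP/(_ y) := cP x; rewrite /= xy cxy eqxx.
Qed.

Lemma ex_f_K_max (R : realType) (f : nat -> R) (n r : nat) :
  (1 < r)%N ->
  is_maximum (free_values f n (complete_graph r)) (ex_f f n (complete_graph r)).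
Proof.
move=> r1; have sy : symmetric (fun _ _ : 'I_n => false) by [].
have ir : irreflexive (fun _ _ : 'I_n => false) by [].
apply: (@maximum_degree_sum _ f n _ (SGraph sy ir)).
  by rewrite /order_of /= card_ord.
by move=> [h [_ /(_ (Ordinal (ltnW r1)) (Ordinal r1) isT)]].
Qed.

Lemma ex_f'_K_max (R : realType) (f : nat -> R) (n r : nat) :
  (1 < r)%N ->
  is_maximum (partite_values f n (complete_graph r))
    (ex_f' f n (complete_graph r)).
Proof.
move=> r1; have sy : symmetric (fun _ _ : 'I_n => false) by [].
have ir : irreflexive (fun _ _ : 'I_n => false) by [].
apply: (@maximum_degree_sum _ f n _ (SGraph sy ir)).
  by rewrite /order_of /= card_ord.
rewrite chromatic_number_complete; case: r r1 => [|[|r]] //= _.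
by exists (fun=> ord0) => x y; rewrite eqxx.
Qed.

(* Main.v *)
Require Import Defs.
From mathcomp Require Import all_boot all_order all_algebra.
From mathcomp Require Import reals.

Set Implicit Arguments.
Unset Strict Implicit.
Unset Printing Implicit Defensive.

Import Order.TTheory GRing.Theory Num.Theory.
Local Open Scope ring_scope.

(** The theorem rests on Erdos' degree majorization: every [K_(k.+1)]-free graph
    [G] admits a partition of its vertices into [k] parts such that the complete
    [k]-partite graph [H] on these parts satisfies [d_G(x) <= d_H(x)] at every
    vertex [x] ([degree_majorization]).  As [f] is non-decreasing, this gives
    [e_f(G) <= e_f(H)] term by term, so the maximum over [K_r]-free graphs is at
    most the maximum over complete [(r-1)]-partite graphs.  The reverse
    inequality holds since a complete [(r-1)]-partite graph is itself
    [K_r]-free, by the pigeonhole principle ([complete_partite_free]).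

    The majorization is proved by induction on [k].  Let [x] be a vertex of
    maximum degree, with neighbourhood [N].  A clique in [N] extends by [x], so
    the induction hypothesis partitions [N] into [k] parts that majorize the
    degrees of the graph induced on [N]; the complement of [N] is taken as one
    more part.  A vertex outside [N] is then joined to all of [N], so its new
    degree is [#|N|], the maximum degree of [G].  A vertex of [N] is joined to
    everything outside [N], and inside [N] its degree has not decreased. *)

Section Cliques.

Variables (T : finType) (e : rel T).
Hypotheses (e_sym : symmetric e) (e_irr : irreflexive e).

Definition clique (C : {set T}) := {in C &, forall x y, x != y -> e x y}.

Lemma cliqueU1 x (C : {set T}) :
  clique C -> {in C, forall y, e x y} -> clique (x |: C).
Proof.
move=> Ccl xC y z; rewrite !inE => /predU1P[->|yC] /predU1P[->|zC].
- by rewrite eqxx.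
- by move=> _; apply: xC.
- by move=> _; rewrite e_sym; apply: xC.
- exact: Ccl.
Qed.

(** Majorization is stated for the subgraph induced on a set [A] so that the
    induction can pass to neighbourhoods without changing the vertex type; the
    parts are numbered by naturals so that a new part can be given the next
    number. *)
Lemma degree_majorization k (A : {set T}) :
    (forall C : {set T}, C \subset A -> clique C -> #|C| != k.+1) ->
  exists2 p : T -> nat, {in A, forall x, p x < k}%N &
    {in A, forall x, #|[set y in A | e x y]| <= #|[set y in A | p x != p y]|}%N.
Proof.
elim: k A => [|k IHk] A Afree; have [A0|[x0 x0A]] := set_0Vmem A.
- by exists (fun=> 0%N) => x; rewrite A0 inE.
- suff x0cl : clique [set x0].
    by have := Afree [set x0]; rewrite sub1set cards1 => /(_ x0A x0cl).
  by move=> x y /set1P-> /set1P->; rewrite eqxx.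
- by exists (fun=> 0%N) => x; rewrite A0 inE.
pose nbr x := [set y in A | e x y].
case: (arg_maxnP (P := [in A]) (fun x => #|nbr x|) x0A) => x /= xA xmax.
set N := nbr x in xmax.
have NA : N \subset A by apply/subsetP => y; rewrite inE => /andP[].
have [|p p_lt p_maj] := IHk N.
  move=> C CN Ccl; have xC y : y \in C -> e x y.
    by move=> /(subsetP CN); rewrite inE => /andP[].
  have xNC : x \notin C by apply/negP => /xC; rewrite e_irr.
  have := Afree (x |: C); rewrite cardsU1 xNC add1n eqSS; apply.
    by rewrite subUset sub1set xA (subset_trans CN NA).
  exact: cliqueU1.
clearbody N.
exists (fun y => if y \in N then p y else k) => y yA /=.
  by case: ifP => // yN; apply/leqW/p_lt.
case: ifPn => yN; last first.
  (* [y] lies in the new part, whose vertices are joined to all of [N]. *)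
  apply: leq_trans (xmax y yA) _; apply/subset_leq_card/subsetP => z zN.
  by rewrite inE zN (subsetP NA) // neq_ltn p_lt ?orbT.
rewrite -(cardsID N [set z in A | e y z]) -(cardsID N [set z in A | _ != _]).
apply: leq_add.
  apply: leq_trans (leq_trans (p_maj y yN) _); apply/subset_leq_card/subsetP => z.
    by rewrite !inE => /andP[/andP[_ ->] ->].
  by rewrite inE => /andP[zN pz]; rewrite !inE (subsetP NA) // zN pz.
apply/subset_leq_card/subsetP => z; rewrite !in_setD => /andP[zN].
rewrite zN in_set => /andP[zA _].
by rewrite in_set zA (negPf zN) neq_ltn p_lt.
Qed.

End Cliques.

Lemma clique_has_copy (G : sgraph) (C : {set G}) :
  clique (@adj G) C -> has_copy (complete_graph #|C|) G.
Proof.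
move=> Ccl; exists (@enum_val G (mem C)); split; first exact: enum_val_inj.
by move=> i j /= ij; apply: Ccl; rewrite ?enum_valP // (inj_eq enum_val_inj).
Qed.

Lemma complete_partite_free k (H : sgraph) :
  complete_partite k H -> is_free (complete_graph k.+1) H.
Proof.
move=> [p pP] [h [_ hP]]; suff /leq_card : injective (p \o h).
  by rewrite !card_ord ltnn.
move=> i j /= pij; apply/eqP; apply: contraT => /hP.
by rewrite pP pij eqxx.
Qed.

Lemma complete_partite_majorant (G : sgraph) k :
    is_free (complete_graph k.+1) G ->
  exists p : G -> 'I_k, forall x : G, (degree x <= #|[pred y | p x != p y]|)%N.
Proof.
move=> Gfree.
have [|p p_lt p_maj] := degree_majorization (@adj_sym G) (@adj_irr G) (k := k)
  (A := [set: G]).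
  move=> C _ Ccl; apply/eqP => Ck; apply: Gfree.
  by rewrite -Ck; apply: clique_has_copy.
exists (fun x => Ordinal (p_lt x (in_setT x))) => x.
have := p_maj x (in_setT x); rewrite /degree.
by congr (_ <= _)%N; apply: eq_card => y; rewrite !inE.
Qed.

Lemma degree_sum_partite_majorant (R : realType) (f : nat -> R) (G : sgraph) k :
    {homo f : a b / (a <= b)%N >-> a <= b} ->
    is_free (complete_graph k.+1) G ->
  exists H : sgraph, [/\ order_of H = order_of G, complete_partite k H
    & degree_sum f G <= degree_sum f H].
Proof.
move=> f_homo /complete_partite_majorant[p p_maj].
have e_sym : symmetric (fun x y : G => p x != p y).
  by move=> x y; rewrite eq_sym.
have e_irr : irreflexive (fun x y : G => p x != p y).
  by move=> x; rewrite eqxx.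
exists (SGraph e_sym e_irr); split => //; first by exists p.
by apply: ler_sum => x _; apply/f_homo/p_maj.
Qed.

Theorem theorem1 (R : realType) (n r : nat) (f : nat -> R) :
  (3 <= r)%N ->
  {homo f : a b / (a <= b)%N >-> a <= b} ->
  ex_f f n (complete_graph r) = ex_f' f n (complete_graph r).
Proof.
case: r => // k k_ge2 f_homo.
have [[G [oG Gfree eG]] ubG] := ex_f_K_max f n (ltnW k_ge2).
have [[H [oH Hpart eH]] ubH] := ex_f'_K_max f n (ltnW k_ge2).
apply: le_anti; apply/andP; split.
  have [H' [oH' H'part leGH']] := degree_sum_partite_majorant f_homo Gfree.
  rewrite -eG; apply: le_trans leGH' (ubH _ _).
  by exists H'; rewrite chromatic_number_complete oH'.
apply: ubG; exists H; split=> //; apply: complete_partite_free.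
by rewrite chromatic_number_complete in Hpart.
Qed.
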